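(* Let $S=\langle \mathbf{e}_0,\mathbf{e}_1,\mathbf{e}_2,\dots\rangle$ be an arbitrary fixed infinite sequence of distinct points of $\mathbb{R}^2$ with $\mathbf{e}_0=(0,0)$, and let the sets $S_n$, $E_n(V)$, $\Phi(n,k)$ and $\Delta(n,k,m)$ be as defined in the context. Then for all integers $n\ge 3$, $k\ge 2$ and $m\ge 1$, both of the following hold: (i) For every $k$-coloring $f$ of $\Phi(n,k)$, the set $\Phi(n,k)$ contains a monochromatic homothetic image of $S_n$; that is, there is $h\in H$ with $h(S_n)\subseteq \Phi(n,k)$ and $|f(h(S_n))|=1$. (ii) For every $k$-coloring $f$ of $\Delta(n,k,m)$ there exist a vector $\mathbf{a}\in\mathbb{R}^2$ and real numbers $\lambda_0,\lambda_1,\dots,\lambda_m$ with $0=\lambda_0<\lambda_1<\dots<\lambda_m$ such that, if for $0\le i<j\le m$ the map $h_{i,j}:\mathbb{R}^2\to\mathbb{R}^2$ is defined by $h_{i,j}(\mathbf{v})=\mathbf{a}+\lambda_i\mathbf{e}_n+(\lambda_j-\lambda_i)\mathbf{v}$, then for all $0\le i<j\le m$ we have $h_{i,j}(S_n)\subseteq \Delta(n,k,m)$ and $|f(h_{i,j}(S_{n-1}))|=1$.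
   Context: Fix an infinite sequence $S=\langle \mathbf{e}_0,\mathbf{e}_1,\mathbf{e}_2,\dots\rangle$ of distinct points of $\mathbb{R}^2$ with $\mathbf{e}_0=(0,0)$. For each integer $n\ge1$ let $S_n=\{\mathbf{e}_0,\dots,\mathbf{e}_{n-1}\}$. For a set $X$, $|X|$ denotes its cardinality. For a positive integer $k$, a $k$-coloring of a set $Y$ is a function from $Y$ to a $k$-element set; for a function $f$ and a set $A$ in its domain, $f(A)=\{f(x):x\in A\}$. $H$ is the set of homotheties of $\mathbb{R}^2$: all maps $h:\mathbb{R}^2\to\mathbb{R}^2$ of the form $h(\mathbf{v})=\mathbf{a}+\lambda\mathbf{v}$ for some $\mathbf{a}\in\mathbb{R}^2$ and some real $\lambda>0$. For $V\subseteq\mathbb{R}^2$ and $h\in H$, $h(V)=\{h(\mathbf{v}):\mathbf{v}\in V\}$. For $V\subseteq\mathbb{R}^2$ and $n\ge2$, define $E_n(V)=\bigcup\{h(S_n): h\in H,\ h(S_{n-1})\subseteq V\}$. For $\mathbf{v}\in\mathbb{R}^2$ and $V,W\subseteq\mathbb{R}^2$, $\mathbf{v}+W=\{\mathbf{v}+\mathbf{w}:\mathbf{w}\in W\}$ and $V+W=\{\mathbf{v}+\mathbf{w}:\mathbf{v}\in V,\mathbf{w}\in W\}$. For integers $k\ge2$, $n\ge3$, $m\ge1$, define finite sets $\Phi(n,k),\Delta(n,k,m)\subseteq\mathbb{R}^2$ recursively by: $\Phi(2,k)=\{\mathbf{e}_0,\mathbf{e}_1,2\mathbf{e}_1,\dots,k\mathbf{e}_1\}$;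 $\Delta(n,k,1)=E_n(\Phi(n-1,k))$; $\Delta(n,k,m+1)=\Delta\big(n,k^{|\Delta(n,k,m)|},1\big)+\Delta(n,k,m)$; $\Phi(n,k)=\Delta(n,k,k)$. A set $Y$ contains a monochromatic homothetic image of $S_n$ under a coloring $f$ of $Y$ if there is $h\in H$ with $h(S_n)\subseteq Y$ and $f$ constant on $h(S_n)$.
   Formalization: In (ii) the maps are taken as h_{i,j}(v) = a + λ_i e_{n-1} + (λ_j − λ_i)v, with e_{n-1} in place of e_n; as printed (ii) fails for m ≥ 2, e.g. when e_0,…,e_{n-1} lie on a line through 0 and e_n does not, since Δ(n,k,m) then lies on that line. *)

(* Defs.v *)
From mathcomp Require Import all_boot all_order all_algebra.
From mathcomp Require Import finmap.
From mathcomp Require Import all_classical all_reals.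

Set Implicit Arguments.
Unset Strict Implicit.
Unset Printing Implicit Defensive.

Import Order.TTheory GRing.Theory Num.Theory.

Local Open Scope classical_set_scope.
Local Open Scope ring_scope.

(* The value is the junk 0 on infinite sets; it is applied below only to the
   finite sets Delta n k m and to sets of colours in 'I_k. *)
Definition set_card (T : choiceType) (A : set T) : nat := #|` fset_set A|.

Definition homotheties (R : realType) : set ('rV[R]_2 -> 'rV[R]_2) :=
  [set h | exists (a : 'rV[R]_2) (lambda : R),
     0 < lambda /\ forall v, h v = a + lambda *: v].

Definition initial_points (R : realType) (e : nat -> 'rV[R]_2) (n : nat) :
    set 'rV[R]_2 :=
  [set e i | i in `I_n].

Definition extension (R : realType) (e : nat -> 'rV[R]_2) (n : nat)
    (V : set 'rV[R]_2) : set 'rV[R]_2 :=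
  \bigcup_(h in [set h | homotheties h /\
                         h @` initial_points e n.-1 `<=` V])
    (h @` initial_points e n).

Definition set_sum (R : realType) (V W : set 'rV[R]_2) : set 'rV[R]_2 :=
  [set v + w | v in V & w in W].

(* Delta and Phi are mutually recursive: Delta n needs Phi n.-1 at arbitrarily
   large numbers of colours. So the recursion on m is first done with
   P : nat -> set 'rV[R]_2 standing for the map k |-> Phi n.-1 k. The intended
   range is 1 <= m, with the junk value set0 at m = 0. *)
Fixpoint Delta_rec (R : realType) (e : nat -> 'rV[R]_2) (n : nat)
    (P : nat -> set 'rV[R]_2) (k m : nat) : set 'rV[R]_2 :=
  match m with
  | 0 => set0
  | 1 => extension e n (P k)
  | m'.+1 => let D := Delta_rec e n P k m' in
             set_sum (extension e n (P (k ^ set_card D)%N)) D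
  end.

(* The intended range is 2 <= n. *)
Fixpoint Phi (R : realType) (e : nat -> 'rV[R]_2) (n k : nat) :
    set 'rV[R]_2 :=
  match n with
  | 0 | 1 => set0
  | 2 => e 0%N |` [set i%:R *: e 1%N | i in [set i : nat | (1 <= i <= k)%N]]
  | n'.+1 => Delta_rec e n (Phi e n') k k
  end.

Definition Delta (R : realType) (e : nat -> 'rV[R]_2) (n k m : nat) :
    set 'rV[R]_2 :=
  Delta_rec e n (Phi e n.-1) k m.

(* The defining recursion in its usual form. *)
Lemma Delta1E (R : realType) (e : nat -> 'rV[R]_2) (n k : nat) :
  Delta e n k 1 = extension e n (Phi e n.-1 k).
Proof. by []. Qed.

Lemma DeltaSE (R : realType) (e : nat -> 'rV[R]_2) (n k m : nat) :
  (1 <= m)%N ->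
  Delta e n k m.+1 =
  set_sum (Delta e n (k ^ set_card (Delta e n k m))%N 1) (Delta e n k m).
Proof. by case: m. Qed.

Lemma PhiE (R : realType) (e : nat -> 'rV[R]_2) (n k : nat) :
  (3 <= n)%N -> Phi e n k = Delta e n k k.
Proof. by case: n => [|[|[|n]]]. Qed.

(* The base points a + lam_i e_{n-1} use e_{n-1}, the last point of S_n. This
   makes the maps a chain: the (i, j) map sends e_{n-1} to a + lam_j e_{n-1},
   the image of e_0 = 0 under every (j, l) map. The index cannot be n, as e_n
   does not enter the definition of Delta n k m. *)
Definition chain_map (R : realType) (e : nat -> 'rV[R]_2) (n : nat)
    (a : 'rV[R]_2) (lam : nat -> R) (i j : nat) (v : 'rV[R]_2) : 'rV[R]_2 :=
  a + lam i *: e n.-1 + (lam j - lam i) *: v.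

(* Main.v *)
(* The chain property (ii) is proved by induction on m, and (i) for n + 1 follows
   from (ii) with m = k: by pigeonhole two of the k + 1 chain points
   [a + lam_i e_n] have the same colour, and the (i, j) map then sends all of
   S_(n+1) to one colour.  To lengthen a chain in D = Delta n k m, colour x by
   the function y |-> f (x + y) on D; a homothety b + mu v whose image of S_(n-1)
   is monochromatic for this product colouring translates the chain found for
   y |-> f (b + y) to the base point a + b, and the new last term is lam_m + mu:
   the new maps are then v |-> (b + mu v) + h_(i,m) v. *)
Require Import Defs.
From mathcomp Require Import all_boot all_order all_algebra.
From mathcomp Require Import finmap.
From mathcomp Require Import all_classical all_reals.

Set Implicit Arguments.
Unset Strict Implicit.
Unset Printing Implicit Defensive.

Import Order.TTheory GRing.Theory Num.Theory.

Local Open Scope classical_set_scope.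
Local Open Scope ring_scope.

Lemma set_card_image_const (T : Type) (U : choiceType) (f : T -> U)
    (A : set T) (x : T) :
  A x -> (forall y, A y -> f y = f x) -> set_card (f @` A) = 1%N.
Proof.
move=> Ax fA; suff -> : f @` A = [set f x] by rewrite /set_card fset_set1 cardfs1.
by apply/seteqP; split=> [_ [y Ay <-]|_ ->]; [exact: fA | exists x].
Qed.

Lemma ordinal_pigeonhole (C : finType) k (p : 'I_k.+1 -> C) :
  #|C| = k -> exists i j : 'I_k.+1, (i < j)%N /\ p i = p j.
Proof.
move=> Ck; have /injectivePn[i [j iNj pij]] : ~~ injectiveb p.
  by apply/negP => /injectiveP /leq_card; rewrite card_ord Ck ltnn.
case: (ltngtP i j) => [ij|ji|/val_inj ij]; [by exists i, j | by exists j, i |].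
by rewrite ij eqxx in iNj.
Qed.

Lemma ltr_of_succ (R : numDomainType) (u : nat -> R) m :
  (forall i, (i < m)%N -> u i < u i.+1) ->
  forall i j, (i < j <= m)%N -> u i < u j.
Proof.
move=> u_lt i; elim=> [|j IHj]; first by rewrite ltn0.
rewrite ltnS leq_eqVlt => /andP[/predU1P[->|ij] jm]; first exact: u_lt.
by apply: lt_trans (u_lt _ jm); rewrite IHj// ij ltnW.
Qed.

Section Ramsey.
Variables (R : realType) (e : nat -> 'rV[R]_2).
Implicit Types (V W : set 'rV[R]_2) (n k m : nat).

(* Colours range over an arbitrary finType of cardinality k, so that functions
   D -> C can be colours too. *)
Definition homothety_ramsey V n k : Prop :=
  forall (C : finType) (f : 'rV[R]_2 -> C), #|C| = k ->
  exists (a : 'rV[R]_2) (mu : R), 0 < mu /\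
    forall i, (i < n)%N -> V (a + mu *: e i) /\ f (a + mu *: e i) = f a.

(** The reference colour is taken at [a + lam i *: e n.-1], the image of [e 0 = 0] under the (i, j)
    map: it does not depend on j, so pigeonhole applies to the chain points alone. *)
Definition chain_ramsey V n k m : Prop :=
  forall (C : finType) (f : 'rV[R]_2 -> C), #|C| = k ->
  exists (a : 'rV[R]_2) (lam : nat -> R),
    [/\ lam 0%N = 0,
        (forall i, (i < m)%N -> lam i < lam i.+1) &
        forall i j, (i < j <= m)%N ->
          (forall l, (l < n)%N -> V (chain_map e n a lam i j (e l))) /\
          (forall l, (l < n.-1)%N ->
             f (chain_map e n a lam i j (e l)) = f (a + lam i *: e n.-1))].

Lemma finite_set_sum V W :
  finite_set V -> finite_set W -> finite_set (set_sum V W).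
Proof. by move=> fV fW; exact: finite_image2. Qed.

(* A homothety is determined by the images of e_0 and e_1. *)
Lemma finite_extension n V : injective e -> e 0%N = 0 ->
  (3 <= n)%N -> finite_set V -> finite_set (extension e n V).
Proof.
move=> e_inj e0 n3 fV.
have e1N0 : e 1%N != 0 by rewrite -e0 (inj_eq e_inj).
have [c ec] : exists c, e 1%N 0 c != 0.
  apply/existsP; apply: contraNT e1N0 => /existsPn e1c.
  by apply/eqP/rowP => c; rewrite mxE; apply/eqP; rewrite -[_ == _]negbK e1c.
(* [g] rebuilds h(e_i) from p = h(e_0) and q = h(e_1), reading the ratio off a coordinate [c] where
   e_1 does not vanish. *)
pose g (pq : 'rV[R]_2 * 'rV[R]_2) i :=
  pq.1 + ((pq.2 - pq.1) 0 c / e 1%N 0 c) *: e i.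
apply: (@sub_finite_set _ _ [set g pq i | pq in V `*` V & i in `I_n]); last first.
  by apply: finite_image2; [exact: finite_setX | exact: finite_II].
move=> _ [h [[a [mu [mu0 hE]]] hV]] [_ [i i_n <-] <-].
have n1 : (1 < n.-1)%N by case: n n3 {hV i_n} => [|[|[|n]]].
exists (h (e 0%N), h (e 1%N)).
  by split; apply: hV; [exists (e 0%N) => //; exists 0%N => //=; exact: ltnW
                       | exists (e 1%N) => //; exists 1%N].
exists i => //; rewrite /g /= !hE e0 scaler0 addr0 addrAC subrr add0r mxE.
by rewrite mulfK.
Qed.

(** Finiteness makes [set_card] the true cardinality in the recursion and lets the points of Delta
    index a product colouring. *)
Lemma finite_Delta n k m : injective e -> e 0%N = 0 -> (3 <= n)%N ->
  (forall k', finite_set (Phi e n.-1 k')) -> finite_set (Delta e n k m).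
Proof.
move=> e_inj e0 n3 fPhi; have fE k' : finite_set (Delta e n k' 1).
  exact: finite_extension.
case: m => [|m]; first exact: finite_set0.
elim: m => [|m IHm] //; rewrite DeltaSE//; exact: finite_set_sum.
Qed.

Lemma finite_Phi n k : injective e -> e 0%N = 0 -> (2 <= n)%N ->
  finite_set (Phi e n k).
Proof.
move=> e_inj e0; case: n => [|[|n]] // _; elim: n k => [|n IHn] k.
  rewrite /= finite_setU; split; first exact: finite_set1.
  apply: finite_image; apply: (@sub_finite_set _ _ `I_k.+1).
    by move=> i /= /andP[_]; rewrite ltnS.
  exact: finite_II.
by rewrite PhiE//; exact: finite_Delta.
Qed.

(** Two of the k + 1 points 0, e_1, ..., k e_1 share a colour, and any two of them form a homothetic
    image of S_2. *)
Lemma Phi2_ramsey k : e 0%N = 0 -> homothety_ramsey (Phi e 2 k) 2 k.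
Proof.
move=> e0 C f Ck; pose p (i : 'I_k.+1) := f ((i : nat)%:R *: e 1%N).
have [i [j [ij pij]]] := ordinal_pigeonhole p Ck.
have PhiP (l : 'I_k.+1) : Phi e 2 k ((l : nat)%:R *: e 1%N).
  case: (posnP l) => [->|l0]; first by left; rewrite scale0r e0.
  by right; exists l => //=; rewrite l0 -ltnS ltn_ord.
exists ((i : nat)%:R *: e 1%N), (j%:R - i%:R); split.
  by rewrite subr_gt0 ltr_nat.
case=> [|[|]]// _; first by rewrite e0 scaler0 addr0.
by rewrite -scalerDl addrC subrK; split; [exact: PhiP | rewrite -[LHS]pij].
Qed.

(** The extension adds the image of e_{n-1} to a monochromatic copy of S_{n-1}; only the colour of
    that last point is left free. *)
Lemma Delta1_ramsey n k (C : finType) (f : 'rV[R]_2 -> C) :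
  homothety_ramsey (Phi e n.-1 k) n.-1 k -> #|C| = k ->
  exists (a : 'rV[R]_2) (mu : R), [/\ 0 < mu,
    (forall i, (i < n)%N -> Delta e n k 1 (a + mu *: e i)) &
    forall i, (i < n.-1)%N -> f (a + mu *: e i) = f a].
Proof.
move=> PhiR /PhiR-/(_ f)[a [mu [mu0 amu]]]; exists a, mu; split=> //; last first.
  by move=> i /amu[].
move=> i i_n; exists (fun v => a + mu *: v); last by exists (e i) => //; exists i.
split; first by exists a, mu.
by move=> _ [_ [l l_n <-] <-]; have [] := amu l l_n.
Qed.

Lemma Delta_chain_ramsey n k m : injective e -> e 0%N = 0 -> (3 <= n)%N ->
  (forall k', homothety_ramsey (Phi e n.-1 k') n.-1 k') ->
  chain_ramsey (Delta e n k m.+1) n k m.+1.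
Proof.
move=> e_inj e0 n3 PhiR; have n_gt0 : (0 < n)%N by exact: leq_trans n3.
have fPhi k' : finite_set (Phi e n.-1 k').
  by apply: finite_Phi => //; rewrite -ltnS prednK.
have n1n : (n.-1 < n)%N by rewrite prednK.
elim: m => [|m IHm] C f Ck.
  have [a [mu [mu0 aD af]]] := Delta1_ramsey f (PhiR k) Ck.
  exists a, (fun i => if i is 0 then 0 else mu); split=> //; first by case.
  case=> [|i] [|[|j]]//; rewrite /chain_map ?andbF// => _.
  by rewrite scale0r addr0 subr0.
have fD : finite_set (Delta e n k m.+1) by exact: finite_Delta.
rewrite DeltaSE//; move: (Delta e n k m.+1) IHm fD => D IHm fD.
(* The product colouring has k ^ |D| colours, the number for which the first summand of the new
   Delta is built. *)
pose F x : {ffun fset_set D -> C} := [ffun y => f (x + val y)].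
have FE x x' y : F x = F x' -> D y -> f (x + y) = f (x' + y).
  move=> Fxx' Dy; have yD : y \in fset_set D by rewrite in_fset_set// inE.
  by have /ffunP/(_ [` yD]%fset) := Fxx'; rewrite !ffunE.
have [|b [mu [mu0 bD bF]]] := Delta1_ramsey F (PhiR (k ^ set_card D)%N).
  by rewrite card_ffun Ck -cardfE.
have [a [lam [lam0 lam_lt lamP]]] := IHm C (fun y => f (b + y)) Ck.
have b1 : Delta e n (k ^ set_card D) 1 b.
  by have := bD 0%N n_gt0; rewrite e0 scaler0 addr0.
pose lam' i := if i == m.+2 then lam m.+1 + mu else lam i.
have lam'E i : (i <= m.+1)%N -> lam' i = lam i.
  by rewrite /lam' => im; rewrite ltn_eqF.
have lam'S : lam' m.+2 = lam m.+1 + mu by rewrite /lam' eqxx.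
exists (a + b), lam'; split.
- by rewrite lam'E.
- move=> i; rewrite ltnS leq_eqVlt => /predU1P[->|im].
    by rewrite lam'S lam'E// ltrDl.
  by rewrite !lam'E ?lam_lt// ltnW.
move=> i j /andP[ij]; rewrite leq_eqVlt => /predU1P[jE|jm].
- have im : (i <= m.+1)%N by rewrite -ltnS -jE.
  have chE v : chain_map e n (a + b) lam' i j v =
      (b + mu *: v) + chain_map e n a lam i m.+1 v.
    rewrite /chain_map jE lam'S lam'E// [lam _ + mu - _]addrAC [in LHS]scalerDl.
    by rewrite [RHS]addrACA [b + _]addrA [b + a]addrC [mu *: v + _]addrC.
  (* For i = m + 1 the old map degenerates to a constant, not covered by the induction hypothesis.
     Its value, the last chain point, lies in D as the image of e_{n-1} under the (0, m + 1) map. *)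
  have [iN|im1] := eqVneq i m.+1.
    have y_D : D (a + lam m.+1 *: e n.-1).
      have /lamP[/(_ n.-1 n1n) + _] : (0 < m.+1 <= m.+1)%N by rewrite ltn0Sn leqnn.
      by rewrite /chain_map lam0 scale0r addr0 subr0.
    have chE' v : chain_map e n (a + b) lam' i j v =
       (b + mu *: v) + (a + lam m.+1 *: e n.-1).
      by rewrite chE /chain_map iN subrr scale0r addr0.
    split=> l l_n; rewrite chE'.
      by exists (b + mu *: e l); [exact: bD | exists (a + lam m.+1 *: e n.-1)].
    by rewrite (FE _ b)//; [rewrite addrCA addrA lam'E// iN | exact: bF].
  have /lamP[chD chf] : (i < m.+1 <= m.+1)%N by rewrite leqnn andbT ltn_neqAle im1.
  split=> l l_n; rewrite chE.
    exists (b + mu *: e l); first exact: bD.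
    by exists (chain_map e n a lam i m.+1 (e l)) => //; exact: chD.
  (* First [FE] replaces b + mu e_l by b, then [chf] applies to the colouring shifted by b. *)
  rewrite (FE _ b) ?chf//; [ | exact: bF | ].
    by rewrite lam'E// addrCA addrA.
  by apply: chD; exact: leq_trans l_n (leq_pred _).
(* When j <= m + 1 the new map is the old one translated by b. *)
rewrite ltnS in jm; have im : (i <= m.+1)%N by exact: ltnW (leq_trans ij jm).
have /lamP[chD chf] : (i < j <= m.+1)%N by rewrite ij.
have chE v : chain_map e n (a + b) lam' i j v = b + chain_map e n a lam i j v.
  by rewrite /chain_map !lam'E// [a + b]addrC -!addrA.
split=> l l_n; rewrite chE.
  by exists b => //; exists (chain_map e n a lam i j (e l)) => //; exact: chD.
by rewrite chf// lam'E// addrCA addrA.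
Qed.

Lemma Phi_ramsey n k : injective e -> e 0%N = 0 -> (2 <= n)%N ->
  homothety_ramsey (Phi e n k) n k.
Proof.
move=> e_inj e0; case: n => [|[|n]] // _; elim: n k => [|n IHn] k.
  exact: Phi2_ramsey.
move=> C f Ck; rewrite PhiE//.
(* There is no colouring with 0 colours, as [f 0] is one. *)
case: k Ck => [/card0_eq/(_ (f 0))//|k] Ck.
have [a [lam [lam0 lam_lt lamP]]] :=
  @Delta_chain_ramsey n.+3 k.+1 k e_inj e0 isT IHn C f Ck.
pose p (i : 'I_k.+2) := f (a + lam i *: e n.+2).
have [i [j [ij pij]]] := ordinal_pigeonhole p Ck.
have jk : (j <= k.+1)%N by rewrite -ltnS.
have /lamP[chD chf] : (i < j <= k.+1)%N by rewrite ij.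
exists (a + lam i *: e n.+2), (lam j - lam i); split.
  by rewrite subr_gt0; apply: (ltr_of_succ lam_lt); rewrite ij.
move=> l l_n; split; first exact: chD.
(* The last point of the copy is the j-th chain point, which pigeonhole gave the colour of the
   i-th. *)
move: l_n; rewrite ltnS leq_eqVlt => /predU1P[->|]; last exact: chf.
by rewrite -addrA -scalerDl [lam i + _]addrC subrK -[LHS]pij.
Qed.

End Ramsey.

Theorem theorem1 (R : realType) (e : nat -> 'rV[R]_2)
    (e_inj : injective e) (e_0 : e 0%N = 0)
    (n k m : nat) (hn : (3 <= n)%N) (hk : (2 <= k)%N) (hm : (1 <= m)%N) :
  (forall f : 'rV[R]_2 -> 'I_k,
     exists h : 'rV[R]_2 -> 'rV[R]_2,
       [/\ homotheties h,
           h @` initial_points e n `<=` Phi e n k &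
           set_card (f @` (h @` initial_points e n)) = 1%N])
  /\
  (forall f : 'rV[R]_2 -> 'I_k,
     exists (a : 'rV[R]_2) (lam : nat -> R),
       [/\ lam 0%N = 0,
           (forall i : nat, (i < m)%N -> lam i < lam i.+1) &
           forall i j : nat, (i < j <= m)%N ->
             chain_map e n a lam i j @` initial_points e n
               `<=` Delta e n k m /\
             set_card (f @` (chain_map e n a lam i j
                           @` initial_points e n.-1)) = 1%N]).
Proof.
have n1 : (1 < n.-1)%N by rewrite -ltnS prednK// (leq_trans _ hn).
have pts l : (0 < l)%N -> initial_points e l 0 by move=> l0; exists 0%N.
split=> f.
  have [|a [mu [mu0 aP]]] := @Phi_ramsey R e n k e_inj e_0 (ltnW hn) 'I_k f.
    exact: card_ord.
  exists (fun v => a + mu *: v); split; first by exists a, mu.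
    by move=> _ [_ [i /aP[ai _] <-] <-].
  rewrite image_comp (@set_card_image_const _ _ _ _ 0)//.
    by apply: pts; exact: leq_trans hn.
  by move=> _ [i /aP[_ fa] <-] /=; rewrite fa scaler0 addr0.
case: m hm => // m _; have [||a [lam [lam0 lam_lt lamP]]] :=
  @Delta_chain_ramsey R e n k m e_inj e_0 hn _ 'I_k f.
- by move=> k'; exact: Phi_ramsey.
- exact: card_ord.
exists a, lam; split=> // i j /lamP[chD chf]; split.
  by move=> _ [_ [l /chD ? <-] <-].
rewrite image_comp (@set_card_image_const _ _ _ _ 0)//.
  by apply: pts; exact: ltnW.
by move=> _ [l /chf fl <-] /=; rewrite fl /chain_map scaler0 addr0.
Qed.
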